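(* Let $r\ge2$ and let $(\rho_i)_{i=1}^r$ be a tuple of quantum states on a common space. Then the average pairwise Holevo fidelity $F_H$, the secrecy-based multivariate fidelity $F_S$, the multivariate SDP fidelity $F_{\mathrm{SDP}}$ and the average pairwise Uhlmann fidelity $F_U$ satisfy $$F_H(\rho_1,\ldots,\rho_r)\le F_S(\rho_1,\ldots,\rho_r)\le F_{\mathrm{SDP}}(\rho_1,\ldots,\rho_r)\le F_U(\rho_1,\ldots,\rho_r)\le\sqrt{F_H(\rho_1,\ldots,\rho_r)}.$$
   Context: A quantum state is a positive semi-definite operator of unit trace on a finite-dimensional complex Hilbert space. For two states: Uhlmann fidelity $F(\rho,\sigma)=\|\sqrt\rho\sqrt\sigma\|_1$; Holevo fidelity $F_H(\rho,\sigma)=\operatorname{Tr}[\sqrt\rho\sqrt\sigma]$. For a tuple: - $F_H(\rho_1,\ldots,\rho_r)=\frac{2}{r(r-1)}\sum_{i<j}F_H(\rho_i,\rho_j)$ and $F_U(\rho_1,\ldots,\rho_r)=\frac{2}{r(r-1)}\sum_{i<j}F(\rho_i,\rho_j)$. - $F_S(\rho_1,\ldots,\rho_r)=\frac1{r-1}\left(r\,S^2-1\right)$ with $S=\sup_\sigma\frac1r\sum_{i=1}^rF(\rho_i,\sigma)$, the supremum over all states $\sigma$ on the same space. - $F_{\mathrm{SDP}}(\rho_1,\ldots,\rho_r)=\frac{1}{r(r-1)}\inf_{Y_1,\ldots,Y_r\ge0}\big\{\sum_{i=1}^r\operatorname{Tr}[Y_i\rho_i]:\sum_{i=1}^r|i\rangle\langle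 i|\otimes Y_i\ge\sum_{i\ne j}|i\rangle\langle j|\otimes I\big\}$, where $\{|i\rangle\}_{i=1}^r$ is the standard basis of $\mathbb C^r$ and $\ge$ is the Loewner order. *)

(* Defs.v *)
From HB Require Import structures.
From mathcomp Require Import all_boot all_order all_algebra.
From mathcomp Require Import boolp classical_sets reals.
From mathcomp.real_closed Require Import complex mxtens.

Set Implicit Arguments.
Unset Strict Implicit.
Unset Printing Implicit Defensive.

Import Order.TTheory GRing.Theory Num.Theory.

Local Open Scope ring_scope.
Local Open Scope classical_set_scope.
Local Open Scope sesquilinear_scope.

Section Operators.
Variable C : numClosedFieldType.

(* The order of C makes [0 <= z] include that z is real. *)
Definition psdmx n (A : 'M[C]_n) : Prop :=
  A \is hermsymmx /\ forall v : 'cV[C]_n, 0 <= (v ^t* *m A *m v) 0 0.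

Definition loewner_le n (A B : 'M[C]_n) : Prop := psdmx (B - A).

Definition quantum_state n (A : 'M[C]_n) : Prop := psdmx A /\ \tr A = 1.

(* Functional calculus along A = P^-1 *m diag_mx d *m P with P unitary.  It is
   meant for A positive semidefinite; then it does not depend on the choice
   of the eigenbasis P. *)
Definition sqrtmx n (A : 'M[C]_n) : 'M[C]_n :=
  invmx (spectralmx A) *m diag_mx (map_mx sqrtC (spectral_diag A))
    *m spectralmx A.

Definition trace_norm n (A : 'M[C]_n) : C := \tr (sqrtmx (A ^t* *m A)).

End Operators.

(* The traces below are real numbers of R[i] when the arguments are states;
   complex.Re brings them into R, where sup and inf are available. *)
Section Fidelities.
Variables (R : realType) (n : nat).
Implicit Types rho sigma : 'M[R[i]]_n.

Definition fidelity rho sigma : R :=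
  complex.Re (trace_norm (sqrtmx rho *m sqrtmx sigma)).

Definition holevo_fidelity rho sigma : R :=
  complex.Re (\tr (sqrtmx rho *m sqrtmx sigma)).

Variable r : nat.
Implicit Type rhos : 'I_r -> 'M[R[i]]_n.

Definition avg_pairwise (F : 'M[R[i]]_n -> 'M[R[i]]_n -> R) rhos : R :=
  2 / (r%:R * (r%:R - 1)) *
    \sum_(i < r) \sum_(j < r | (i < j)%N) F (rhos i) (rhos j).

Definition F_H rhos : R := avg_pairwise holevo_fidelity rhos.

Definition F_U rhos : R := avg_pairwise fidelity rhos.

Definition secrecy rhos : R :=
  sup [set r%:R^-1 * \sum_(i < r) fidelity (rhos i) sigma
      | sigma in [set sigma | quantum_state sigma]].

Definition F_S rhos : R := (r%:R - 1)^-1 * (r%:R * secrecy rhos ^+ 2 - 1).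

Definition SDP_feasible (Y : 'I_r -> 'M[R[i]]_n) : Prop :=
  (forall i, psdmx (Y i)) /\
  loewner_le
    (\sum_(i < r) \sum_(j < r | i != j) delta_mx i j *t (1%:M : 'M[R[i]]_n))
    (\sum_(i < r) delta_mx i i *t Y i).

Definition F_SDP rhos : R :=
  (r%:R * (r%:R - 1))^-1 *
    inf [set complex.Re (\sum_(i < r) \tr (Y i *m rhos i))
        | Y in [set Y | SDP_feasible Y]].

End Fidelities.

(* Main.v *)
Require Import Defs.
From HB Require Import structures.
From mathcomp Require Import all_boot all_order all_algebra.
From mathcomp Require Import boolp classical_sets reals.
From mathcomp.real_closed Require Import complex mxtens.
From mathcomp Require Import ring.

Set Implicit Arguments.
Unset Strict Implicit.
Unset Printing Implicit Defensive.

Import Order.TTheory GRing.Theory Num.Theory.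

Local Open Scope ring_scope.

(** Write A_i = sqrt(rho_i), T = sum_i A_i.

    F_H <= F_S: Tr T^2 = r + 2 sum_(i<j) F_H(rho_i, rho_j), and testing the
    secrecy supremum on sigma = T^2 / Tr T^2 gives at least sqrt(Tr T^2) for
    sum_i F(rho_i, sigma), because |Tr X| <= ||X||_1.

    F_S <= F_SDP: a polar decomposition yields contractions W_i such that
    sum_i F(rho_i, sigma) = Tr[sqrt(sigma) sum_i A_i W_i].  By Cauchy-Schwarz its
    square is at most the squared Hilbert-Schmidt norm of sum_i A_i W_i, which the
    SDP constraint, evaluated on the columns of the A_i W_i, bounds by
    r + sum_i Tr[Y_i rho_i].

    F_SDP <= F_U: by Alberti's formula each pair (i, j) has mutually inverse
    positive matrices Z_ij, Z_ji with Tr[Z_ij rho_i] + Tr[Z_ji rho_j] arbitrarily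
    close to 2 F(rho_i, rho_j); then Y_i = sum_(j != i) Z_ij is feasible.

    F_U <= sqrt F_H: F(rho, sigma)^2 <= F_H(rho, sigma) by Cauchy-Schwarz on
    fourth roots of the states, followed by Jensen for the average over pairs. *)

(** * Positive semidefinite matrices and functional calculus *)

Section Positive.
Local Open Scope sesquilinear_scope.
Variable C : numClosedFieldType.

Lemma adjmxM m n p (A : 'M[C]_(m, n)) (B : 'M[C]_(n, p)) :
  (A *m B) ^t* = B ^t* *m A ^t*.
Proof. by rewrite trmx_mul map_mxM. Qed.

Lemma adjmxD m n (A B : 'M[C]_(m, n)) : (A + B) ^t* = A ^t* + B ^t*.
Proof. by rewrite linearD map_mxD. Qed.

Lemma adjmxB m n (A B : 'M[C]_(m, n)) : (A - B) ^t* = A ^t* - B ^t*.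
Proof. by rewrite linearB map_mxB. Qed.

Lemma adjmxZ m n a (A : 'M[C]_(m, n)) : (a *: A) ^t* = a^* *: A ^t*.
Proof. by rewrite linearZ map_mxZ. Qed.

Lemma adjmx1 n : (1%:M : 'M[C]_n) ^t* = 1%:M.
Proof. by rewrite trmx1 map_mx1. Qed.

Lemma adjmx_sum m n I (s : seq I) (P : pred I) (F : I -> 'M[C]_(m, n)) :
  (\sum_(i <- s | P i) F i) ^t* = \sum_(i <- s | P i) (F i) ^t*.
Proof. by rewrite linear_sum raddf_sum. Qed.

Lemma adj_mulmx_diag m n (A : 'M[C]_(m, n)) j :
  (A ^t* *m A) j j = \sum_i `|A i j| ^+ 2.
Proof. by rewrite mxE; apply: eq_bigr => i _; rewrite !mxE mulrC normCK. Qed.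

Lemma psdmx_adj n (A : 'M[C]_n) : psdmx A -> A ^t* = A.
Proof. by case=> /is_hermitianmxP AA _; rewrite [RHS]AA expr0 scale1r. Qed.

Lemma psdmxI n (A : 'M[C]_n) : A ^t* = A ->
  (forall v : 'cV[C]_n, 0 <= (v ^t* *m A *m v) 0 0) -> psdmx A.
Proof. by move=> AA; split=> //; apply/is_hermitianmxP; rewrite expr0 scale1r AA. Qed.

Lemma psdmx_gram m n (K : 'M[C]_(m, n)) : psdmx (K ^t* *m K).
Proof.
apply: psdmxI => [|v]; first by rewrite adjmxM trmxCK.
rewrite mulmxA -adjmxM -mulmxA adj_mulmx_diag sumr_ge0 // => i _.
by rewrite exprn_ge0.
Qed.

Lemma psdmx_conj m n (K : 'M[C]_(m, n)) A : psdmx A -> psdmx (K ^t* *m A *m K).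
Proof.
move=> pA; apply: psdmxI => [|v].
  by rewrite !adjmxM trmxCK psdmx_adj // mulmxA.
have := pA.2 (K *m v); rewrite adjmxM !mulmxA; exact.
Qed.

Lemma psdmxD n (A B : 'M[C]_n) : psdmx A -> psdmx B -> psdmx (A + B).
Proof.
move=> pA pB; apply: psdmxI => [|v]; first by rewrite adjmxD !psdmx_adj.
by rewrite mulmxDr mulmxDl mxE addr_ge0 ?pA.2 ?pB.2.
Qed.

Lemma psdmx0 n : psdmx (0 : 'M[C]_n).
Proof.
apply: psdmxI => [|v]; first by rewrite trmx0 map_mx0.
by rewrite mulmx0 mul0mx mxE.
Qed.

Lemma psdmx1 n : psdmx (1%:M : 'M[C]_n).
Proof. by have := psdmx_gram (1%:M : 'M[C]_n); rewrite adjmx1 mulmx1. Qed.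

Lemma psdmx_sum n I (s : seq I) (P : pred I) (F : I -> 'M[C]_n) :
  (forall i, P i -> psdmx (F i)) -> psdmx (\sum_(i <- s | P i) F i).
Proof.
by move=> pF; apply: big_ind => //; [exact: psdmx0 | exact: psdmxD].
Qed.

Lemma psdmxZ n a (A : 'M[C]_n) : 0 <= a -> psdmx A -> psdmx (a *: A).
Proof.
move=> a0 pA; apply: psdmxI => [|v].
  by rewrite adjmxZ psdmx_adj // geC0_conj.
by rewrite -scalemxAr -scalemxAl mxE mulr_ge0 // pA.2.
Qed.

Lemma psdmx_diag_ge0 n (A : 'M[C]_n) i : psdmx A -> 0 <= A i i.
Proof.
move=> pA; have := pA.2 (delta_mx i 0).
by rewrite trmx_delta map_delta_mx -rowE -colE !mxE.
Qed.

Lemma tr_psdmx_ge0 n (A : 'M[C]_n) : psdmx A -> 0 <= \tr A.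
Proof. by move=> pA; rewrite sumr_ge0 // => i _; apply: psdmx_diag_ge0. Qed.

(* Functional calculus: [f] applied to the eigenvalues of [A]; meaningful when
   [A] is normal. *)
Definition funmx n (f : C -> C) (A : 'M[C]_n) : 'M[C]_n :=
  (spectralmx A) ^t* *m diag_mx (map_mx f (spectral_diag A)) *m spectralmx A.

Lemma sqrtmxE n (A : 'M[C]_n) : sqrtmx A = funmx sqrtC A.
Proof. by rewrite /sqrtmx invmx_unitary ?spectral_unitarymx. Qed.

Lemma funmxM n (f g : C -> C) (A : 'M[C]_n) :
  funmx f A *m funmx g A = funmx (fun x => f x * g x) A.
Proof.
rewrite /funmx !mulmxA mulmxtVK ?spectral_unitarymx //; congr (_ *m _).
rewrite -!mulmxA; congr (_ *m _).
apply/matrixP=> i j; rewrite mul_diag_mx !mxE.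
by case: eqP => [->|_]; rewrite ?mulr1n // !mulr0n mulr0.
Qed.

Lemma funmxD n (f g : C -> C) (A : 'M[C]_n) :
  funmx f A + funmx g A = funmx (fun x => f x + g x) A.
Proof.
rewrite /funmx -mulmxDl -mulmxDr; congr (_ *m _ *m _).
by apply/matrixP=> i j; rewrite !mxE mulrnDl.
Qed.

Lemma funmxB n (f g : C -> C) (A : 'M[C]_n) :
  funmx f A - funmx g A = funmx (fun x => f x - g x) A.
Proof.
rewrite /funmx -mulmxBl -mulmxBr; congr (_ *m _ *m _).
by apply/matrixP=> i j; rewrite !mxE mulrnBl.
Qed.

Lemma funmx_cst n c (A : 'M[C]_n) : funmx (fun=> c) A = c%:M.
Proof.
have -> : funmx (fun=> c) A = (spectralmx A) ^t* *m c%:M *m spectralmx A.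
  by congr (_ *m _ *m _); apply/matrixP=> i j; rewrite !mxE.
rewrite -mulmxA mul_scalar_mx -scalemxAr -invmx_unitary ?spectral_unitarymx //.
by rewrite mulVmx ?spectral_unit // scalemx1.
Qed.

Lemma tr_funmx n (f : C -> C) (A : 'M[C]_n) :
  \tr (funmx f A) = \sum_i f (spectral_diag A 0 i).
Proof.
rewrite /funmx -mulmxA mxtrace_mulC -mulmxA (unitarymxP (spectral_unitarymx A)).
by rewrite mulmx1 mxtrace_diag; apply: eq_bigr => i _; rewrite mxE.
Qed.

Lemma funmx_id n (A : 'M[C]_n) : psdmx A -> funmx id A = A.
Proof.
case=> /hermitian_normalmx /orthomx_spectralP A_eq _; rewrite [RHS]A_eq.
rewrite invmx_unitary ?spectral_unitarymx //; congr (_ *m _ *m _).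
by apply/matrixP=> i j; rewrite !mxE.
Qed.

Lemma spectral_diag_ge0 n (A : 'M[C]_n) i : psdmx A -> 0 <= spectral_diag A 0 i.
Proof.
move=> pA; have := psdmx_conj ((spectralmx A) ^t*) pA.
rewrite trmxCK -{2}(funmx_id pA) /funmx !mulmxA.
rewrite (unitarymxP (spectral_unitarymx A)) mul1mx -mulmxA.
rewrite (unitarymxP (spectral_unitarymx A)) mulmx1 => /(psdmx_diag_ge0 i).
by rewrite !mxE eqxx.
Qed.

(** The spectrum of a positive matrix is nonnegative, so an identity between functions of [A] need
    only be checked on scalars x >= 0. *)
Lemma eq_funmx n (f g : C -> C) (A : 'M[C]_n) : psdmx A ->
  (forall x, 0 <= x -> f x = g x) -> funmx f A = funmx g A.
Proof.
move=> pA fg; congr (_ *m _ *m _); congr diag_mx.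
by apply/rowP=> i; rewrite !mxE fg // spectral_diag_ge0.
Qed.

Lemma psdmx_funmx n (f : C -> C) (A : 'M[C]_n) : psdmx A ->
  (forall x, 0 <= x -> 0 <= f x) -> psdmx (funmx f A).
Proof.
move=> pA f0; apply: psdmx_conj.
have -> : diag_mx (map_mx f (spectral_diag A)) =
    (diag_mx (map_mx (sqrtC \o f) (spectral_diag A))) ^t* *m
     diag_mx (map_mx (sqrtC \o f) (spectral_diag A)).
  apply/matrixP=> i j; rewrite tr_diag_mx map_diag_mx mul_diag_mx !mxE.
  case: eqP => [->|_]; rewrite ?mulr0n ?mulr0 // !mulr1n.
  have s0 : 0 <= sqrtC (f (spectral_diag A 0 j)).
    by rewrite sqrtC_ge0 f0 ?spectral_diag_ge0.
  by rewrite /= [X in X * _](geC0_conj s0) -expr2 sqrtCK.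
exact: psdmx_gram.
Qed.

Lemma psdmx_sqrt n (A : 'M[C]_n) : psdmx A -> psdmx (sqrtmx A).
Proof. by move=> pA; rewrite sqrtmxE; apply: psdmx_funmx => // x; rewrite sqrtC_ge0. Qed.

Lemma sqrtmxK n (A : 'M[C]_n) : psdmx A -> sqrtmx A *m sqrtmx A = A.
Proof.
move=> pA; rewrite sqrtmxE funmxM -[RHS](funmx_id pA); apply: eq_funmx => // x _.
by rewrite -expr2 sqrtCK.
Qed.

(* For two eigenbases with change of basis U, equality of the squares gives
   u_ij e_j^2 = d_i^2 u_ij, hence u_ij e_j = d_i u_ij by nonnegativity. *)
Lemma sqr_psdmx_inj n (A B : 'M[C]_n) : psdmx A -> psdmx B ->
  A *m A = B *m B -> A = B.
Proof.
move=> pA pB AB.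
set P := spectralmx A; set Q := spectralmx B.
have PP : P *m P ^t* = 1%:M by apply/unitarymxP/spectral_unitarymx.
have QQ : Q *m Q ^t* = 1%:M by apply/unitarymxP/spectral_unitarymx.
have PP' : P ^t* *m P = 1%:M by apply: mulmx1C.
have QQ' : Q ^t* *m Q = 1%:M by apply: mulmx1C.
pose U := P *m Q ^t*.
have key (f : C -> C) : P *m funmx f A *m Q ^t* =
    diag_mx (map_mx f (spectral_diag A)) *m U.
  by rewrite /funmx -/P !mulmxA PP mul1mx.
have key' (f : C -> C) : P *m funmx f B *m Q ^t* =
    U *m diag_mx (map_mx f (spectral_diag B)).
  by rewrite /funmx -/Q !mulmxA -(mulmxA _ Q) QQ mulmx1.
suff e : diag_mx (map_mx id (spectral_diag A)) *m U =
         U *m diag_mx (map_mx id (spectral_diag B)).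
  move: e; rewrite -key -key' !funmx_id // => /(congr1 (fun M => P ^t* *m M *m Q)).
  by rewrite !mulmxA PP' !mul1mx -!mulmxA QQ' !mulmx1.
have e2 : diag_mx (map_mx (fun x => x * x) (spectral_diag A)) *m U =
         U *m diag_mx (map_mx (fun x => x * x) (spectral_diag B)).
  by rewrite -key -key' -!funmxM !funmx_id // AB.
clearbody U; apply/matrixP=> i j; move/matrixP/(_ i j): e2.
rewrite !mul_diag_mx !mul_mx_diag !mxE.
case: (eqVneq (U i j) 0) => [->|u0]; first by rewrite !mulr0 !mul0r.
rewrite mulrC => /(mulfI u0) /eqP.
rewrite -!expr2 eqrXn2 ?spectral_diag_ge0 // => /eqP ->; exact: mulrC.
Qed.

Lemma sqrtmx_uniq n (A B : 'M[C]_n) : psdmx A -> psdmx B -> B *m B = A ->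
  sqrtmx A = B.
Proof.
move=> pA pB BA; apply: sqr_psdmx_inj => //; first exact: psdmx_sqrt.
by rewrite sqrtmxK.
Qed.

(** By cyclicity the trace is that of sqrt(A) B sqrt(A), a conjugate of [B]. *)
Lemma tr_mul_psdmx_ge0 n (A B : 'M[C]_n) : psdmx A -> psdmx B -> 0 <= \tr (A *m B).
Proof.
move=> pA pB; rewrite -(sqrtmxK pA) -mulmxA mxtrace_mulC.
rewrite -{1}(psdmx_adj (psdmx_sqrt pA)).
exact/tr_psdmx_ge0/psdmx_conj.
Qed.

Lemma ler_tr_mul n (A B D : 'M[C]_n) : psdmx A -> loewner_le B D ->
  \tr (A *m B) <= \tr (A *m D).
Proof.
move=> pA BD; rewrite -subr_ge0 -raddfB /= -mulmxBr.
exact: tr_mul_psdmx_ge0.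
Qed.

(** Flattening with [mxvec] turns the Hilbert-Schmidt inner product into [dotmx]. *)
Lemma tr_CauchySchwarz m n (X Y : 'M[C]_(m, n)) :
  `|\tr (X *m Y ^t*)| ^+ 2 <= \tr (X *m X ^t*) * \tr (Y *m Y ^t*).
Proof.
have E (U V : 'M[C]_(m, n)) :
    \tr (U *m V ^t*) = dotmx (mxvec U) (mxvec V).
  rewrite dotmxE mxE /mxtrace; under eq_bigr do rewrite mxE.
  rewrite pair_bigA /= (reindex _ (curry_mxvec_bij _ _)) /=.
  by apply: eq_bigr => -[i j] _; rewrite !(mxE, mxvecE).
rewrite !E; have [] := CauchySchwarz (@dotmx C (m * n)) (mxvec X) (mxvec Y).
by [].
Qed.

Lemma trace_norm_ge0 n (X : 'M[C]_n) : 0 <= trace_norm X.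
Proof. by apply/tr_psdmx_ge0/psdmx_sqrt/psdmx_gram. Qed.

(* In an eigenbasis of |X| the k-th diagonal entry of X is bounded by the norm
   of the k-th column, which is the k-th eigenvalue of |X|. *)
Lemma ler_norm_tr n (X : 'M[C]_n) : `|\tr X| <= trace_norm X.
Proof.
set A := X ^t* *m X; have pA : psdmx A by apply: psdmx_gram.
rewrite /trace_norm -/A sqrtmxE tr_funmx.
set P := spectralmx A.
have PP : P *m P ^t* = 1%:M by apply/unitarymxP/spectral_unitarymx.
have PP' : P ^t* *m P = 1%:M by apply: mulmx1C.
pose Y := P *m X *m P ^t*.
have -> : \tr X = \tr Y by rewrite mxtrace_mulC mulmxA PP' mul1mx.
apply: (le_trans (ler_norm_sum _ _ _)); apply: ler_sum => k _.
have -> : spectral_diag A 0 k = (Y ^t* *m Y) k k.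
  rewrite /Y !adjmxM trmxCK !mulmxA -(mulmxA _ (P ^t*) P) PP' mulmx1.
  rewrite -(mulmxA P) -/A -{2}(funmx_id pA) /funmx -/P !mulmxA PP mul1mx -mulmxA PP.
  by rewrite mulmx1 !mxE eqxx.
rewrite adj_mulmx_diag -(@ler_pXn2r _ 2) ?nnegrE ?sqrtC_ge0 ?sumr_ge0 //; last first.
  by move=> i _; rewrite exprn_ge0.
rewrite sqrtCK (bigD1 k) //= lerDl sumr_ge0 // => i _.
by rewrite exprn_ge0.
Qed.

(* W = X |X|^+ is a partial isometry, so W W^* is an orthogonal projection. *)
Lemma polar_contraction n (X : 'M[C]_n) : exists W : 'M[C]_n,
  W ^t* *m X = sqrtmx (X ^t* *m X) /\ loewner_le (W *m W ^t*) 1%:M.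
Proof.
set A := X ^t* *m X; have pA : psdmx A by apply: psdmx_gram.
(* As 0^-1 = 0, [G] is the pseudo-inverse of |X| even when [X] is singular. *)
pose G := funmx (fun x => (sqrtC x)^-1) A.
have pG : psdmx G.
  by apply: psdmx_funmx => // x x0; rewrite invr_ge0 sqrtC_ge0.
have mulVs x : (sqrtC x)^-1 * x = sqrtC x :> C.
  have [->|x0] := eqVneq x 0; first by rewrite sqrtC0 mulr0.
  by rewrite -{2}[x]sqrtCK expr2 mulrA mulVf ?mul1r // sqrtC_eq0.
have GA : G *m A = sqrtmx A.
  rewrite -[X in _ *m X](funmx_id pA) funmxM sqrtmxE.
  by apply: eq_funmx => // x _; apply: mulVs.
(* Inserted in the middle of P P, this makes [P] below idempotent; then 1 - P is a projection too,
   hence its own Gram matrix. *)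
have GAGG : G *m A *m G *m G = G.
  rewrite GA sqrtmxE /G !funmxM; apply: eq_funmx => // x _.
  have [->|x0] := eqVneq x 0; first by rewrite sqrtC0 invr0 !mul0r.
  by rewrite mulfV ?mul1r // sqrtC_eq0.
clearbody G; exists (X *m G); rewrite adjmxM (psdmx_adj pG).
split; first by rewrite -mulmxA.
set P := _ *m _.
have P2 : P *m P = P.
  by rewrite /P -{6}GAGG /A !mulmxA.
have Pa : P ^t* = P by rewrite /P !adjmxM trmxCK (psdmx_adj pG) !mulmxA.
rewrite /loewner_le; have -> : 1%:M - P = (1%:M - P) ^t* *m (1%:M - P).
  by rewrite adjmxB adjmx1 Pa mulmxBl mul1mx mulmxBr mulmx1 P2 subrr subr0.
exact: psdmx_gram.
Qed.
End Positive.

(** * Fidelities of states *)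

Section States.
Local Open Scope sesquilinear_scope.
Variable C : numClosedFieldType.

Lemma tr_sqrtmx_state n (A : 'M[C]_n) : quantum_state A ->
  \tr (sqrtmx A *m sqrtmx A) = 1.
Proof. by case=> pA tA; rewrite sqrtmxK. Qed.

Lemma tr_mul_psdmx_sqr_le n (A B : 'M[C]_n) : psdmx A -> psdmx B ->
  \tr (A *m B) ^+ 2 <= \tr (A *m A) * \tr (B *m B).
Proof.
move=> pA pB; have := tr_CauchySchwarz A B.
by rewrite !psdmx_adj // ger0_norm ?tr_mul_psdmx_ge0.
Qed.

Lemma ler1_sqr (x : C) : 0 <= x -> x ^+ 2 <= 1 -> x <= 1.
Proof. by move=> x0; rewrite -[X in _ <= X](expr1n _ 2) ler_pXn2r ?nnegrE. Qed.

(** The polar identity gives this after taking adjoints, since |X| is self-adjoint. *)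
Lemma tr_polar n (X : 'M[C]_n) : exists W : 'M[C]_n,
  trace_norm X = \tr (X ^t* *m W) /\ loewner_le (W *m W ^t*) 1%:M.
Proof.
have [W [WX W1]] := polar_contraction X; exists W; split=> //.
rewrite /trace_norm -(psdmx_adj (psdmx_sqrt (psdmx_gram X))) -WX.
by rewrite adjmxM trmxCK.
Qed.

(** Let A, B be the square roots and a, b the fourth roots of the states. The polar decomposition
    gives F = Tr[B A W], which is the Hilbert-Schmidt product of b a and b W^* a. In Cauchy-Schwarz
    the first factor is Tr[A B] and the second is at most 1. *)
Lemma sqr_trace_norm_sqrtmx_le n (rho sigma : 'M[C]_n) :
  quantum_state rho -> quantum_state sigma ->
  trace_norm (sqrtmx rho *m sqrtmx sigma) ^+ 2 <=
    \tr (sqrtmx rho *m sqrtmx sigma).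
Proof.
move=> qr qs; have := tr_sqrtmx_state qr; have := tr_sqrtmx_state qs.
have pA := psdmx_sqrt qr.1; have pB := psdmx_sqrt qs.1.
move: (sqrtmx rho) (sqrtmx sigma) pA pB => A B pA pB tB tA.
have [W [FE W1]] := tr_polar (A *m B).
have := trace_norm_ge0 (A *m B); move: FE; rewrite adjmxM !psdmx_adj // => -> F0.
have pa := psdmx_sqrt pA; have pb := psdmx_sqrt pB.
have := sqrtmxK pA; have := sqrtmxK pB.
move: (sqrtmx A) (sqrtmx B) pa pb => a b pa pb bb aa.
have FE : \tr (B *m A *m W) = \tr ((b *m a) *m (b *m W ^t* *m a) ^t*).
  rewrite !adjmxM trmxCK !psdmx_adj // -bb -aa !mulmxA.
  by rewrite [RHS]mxtrace_mulC !mulmxA.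
set M := W ^t* *m A *m W.
have pM : psdmx M by apply: psdmx_conj.
(* Cauchy-Schwarz reduces this to Tr[M M] <= 1. Cyclicity brings W W^* into that trace twice;
   replacing each occurrence by the identity leaves Tr[A A] = 1. *)
have MB : \tr (M *m B) <= 1.
  apply: ler1_sqr; first exact: tr_mul_psdmx_ge0.
  apply: (le_trans (tr_mul_psdmx_sqr_le pM pB)); rewrite tB mulr1.
  have -> : \tr (M *m M) = \tr (A *m (W *m W ^t*) *m A *m (W *m W ^t*)).
    rewrite /M -!mulmxA mxtrace_mulC; congr (\tr _); rewrite !mulmxA //.
  apply: (@le_trans _ _ (\tr (A *m (W *m W ^t*) *m A *m 1%:M))).
    apply: ler_tr_mul => //.
    have := psdmx_gram (W ^t* *m A); rewrite adjmxM trmxCK psdmx_adj //.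
    by rewrite !mulmxA.
  have -> : \tr (A *m (W *m W ^t*) *m A *m 1%:M) = \tr (A *m A *m (W *m W ^t*)).
    by rewrite mulmx1 mxtrace_mulC !mulmxA.
  rewrite -[X in _ <= X]tA -[X in _ <= \tr X]mulmx1.
  apply: ler_tr_mul => //.
  by have := psdmx_gram A; rewrite psdmx_adj.
rewrite -(ger0_norm F0) FE; apply: (le_trans (tr_CauchySchwarz _ _)).
have -> : \tr (b *m W ^t* *m a *m (b *m W ^t* *m a) ^t*) = \tr (M *m B).
  rewrite /M !adjmxM trmxCK (psdmx_adj pa) (psdmx_adj pb) -bb -[X in _ = \tr (_ *m X *m _ *m _)]aa.
  by rewrite !mulmxA [RHS]mxtrace_mulC !mulmxA.
have -> : \tr (b *m a *m (b *m a) ^t*) = \tr (A *m B).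
  by rewrite !adjmxM !psdmx_adj // -aa -bb !mulmxA [RHS]mxtrace_mulC !mulmxA.
by rewrite ler_piMr // tr_mul_psdmx_ge0.
Qed.

(** Here F^2 <= F_H <= 1. The bound makes the supremum in [secrecy] finite. *)
Lemma trace_norm_sqrtmx_le1 n (rho sigma : 'M[C]_n) :
  quantum_state rho -> quantum_state sigma ->
  trace_norm (sqrtmx rho *m sqrtmx sigma) <= 1.
Proof.
move=> qr qs; apply: ler1_sqr; first exact: trace_norm_ge0.
apply: (le_trans (sqr_trace_norm_sqrtmx_le qr qs)).
have pA := psdmx_sqrt qr.1; have pB := psdmx_sqrt qs.1.
apply: ler1_sqr; first exact: tr_mul_psdmx_ge0.
by have := tr_mul_psdmx_sqr_le pA pB; rewrite !tr_sqrtmx_state // mulr1.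
Qed.

Lemma exists_state_sum_fidelity_ge n r (rho : 'I_r -> 'M[C]_n)
    (T := \sum_i sqrtmx (rho i)) :
  (0 < r)%N -> (forall i, quantum_state (rho i)) ->
  exists2 sigma, quantum_state sigma &
    sqrtC (\tr (T *m T)) <= \sum_i trace_norm (sqrtmx (rho i) *m sqrtmx sigma).
Proof.
move=> r0 qr.
have pS i : psdmx (sqrtmx (rho i)) by apply/psdmx_sqrt/(qr i).1.
have pT : psdmx T by apply: psdmx_sum.
have pTT : psdmx (T *m T) by have := psdmx_gram T; rewrite psdmx_adj.
set t := \tr (T *m T).
(* Splitting off one index, available since r > 0, writes t as 1 plus traces of products of positive
   matrices. *)
have t0 : 0 < t.
  rewrite lt0r tr_psdmx_ge0 // andbT; apply/eqP => tE.
  pose i := Ordinal r0.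
  have := tr_mul_psdmx_ge0 pT (psdmx_sum (index_enum _) (P := predC1 i) (fun j _ => pS j)).
  have := tr_mul_psdmx_ge0 (pS i) (psdmx_sum (index_enum _) (P := predC1 i) (fun j _ => pS j)).
  set U := \sum_(j <- _ | _) _ => SU TU.
  have TE : T = sqrtmx (rho i) + U by rewrite /T (bigD1 i).
  move: tE; rewrite /t {2}TE mulmxDr {1}TE mulmxDl !raddfD /= tr_sqrtmx_state // => /eqP.
  apply/negP; rewrite gt_eqF // -addrA ltr_wpDr ?ltr01 // addr_ge0 //.
  by rewrite mxtrace_mulC.
have s0 : 0 < sqrtC t by rewrite sqrtC_gt0.
have sV0 : 0 <= (sqrtC t)^-1 by rewrite invr_ge0 ltW.
have tV0 : 0 <= t^-1 by rewrite invr_ge0 ltW.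
have qs : quantum_state (t^-1 *: (T *m T)).
  by split; [apply: psdmxZ | rewrite mxtraceZ mulVf ?gt_eqF].
exists (t^-1 *: (T *m T)) => //.
have -> : sqrtmx (t^-1 *: (T *m T)) = (sqrtC t)^-1 *: T.
  apply: sqrtmx_uniq; [exact: qs.1 | exact: psdmxZ |].
  by rewrite -scalemxAl -scalemxAr scalerA -invfM -expr2 sqrtCK.
(* The traces Tr[A_i T] add up to t, so those of A_i sqrt(sigma) add up to sqrt(t); each is at most
   the corresponding trace norm. *)
have tE : sqrtC t = \sum_i (sqrtC t)^-1 * \tr (sqrtmx (rho i) *m T).
  rewrite -mulr_sumr -raddf_sum /= -mulmx_suml -/T -/t -[X in _ * X]sqrtCK expr2 mulrA.
  by rewrite mulVf ?mul1r // gt_eqF.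
rewrite [X in X <= _]tE; apply: ler_sum => i _; rewrite -scalemxAr.
apply: (le_trans _ (ler_norm_tr _)); rewrite mxtraceZ ger0_norm //.
by rewrite mulr_ge0 // tr_mul_psdmx_ge0.
Qed.

End States.

(** * Near-minimizers in Alberti's formula *)

Section Alberti.
Local Open Scope sesquilinear_scope.
Variable C : numClosedFieldType.

(* With N = |sqrt(rho) sqrt(sigma)|, h = sqrt(sigma) + d and G = N + eps, the
   matrices h^-1 G h^-1 and h G^-1 h are mutually inverse and nearly attain
   Alberti's infimum; first eps, then d is chosen small. *)
Lemma exists_alberti_pair n (rho sigma : 'M[C]_n) (e : C) :
  psdmx rho -> psdmx sigma -> 0 < e ->
  exists K L : 'M[C]_n, [/\ L *m K = 1%:M,
    \tr (L ^t* *m L *m rho) <= trace_norm (sqrtmx rho *m sqrtmx sigma) + e &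
    \tr (K *m K ^t* *m sigma) <= trace_norm (sqrtmx rho *m sqrtmx sigma) + e].
Proof.
move=> pr ps e0; set F := trace_norm _.
have pA := psdmx_sqrt pr; have pB := psdmx_sqrt ps.
set B := sqrtmx sigma in pB F *; set A := sqrtmx rho in pA F *.
have XX : (A *m B) ^t* *m (A *m B) = B *m rho *m B.
  by rewrite adjmxM (psdmx_adj pA) (psdmx_adj pB) -(sqrtmxK pr) !mulmxA.
have pX : psdmx (B *m rho *m B) by rewrite -XX; apply: psdmx_gram.
pose N := sqrtmx (B *m rho *m B).
have pN : psdmx N by apply: psdmx_sqrt.
have FE : F = \tr N by rewrite /F /trace_norm XX.
have NN : N *m N = B *m rho *m B by apply: sqrtmxK.
(* Chosen so that Tr[eps 1] = n eps <= e; the successor covers n = 0. *)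
pose eps := e / n.+1%:R.
have eps0 : 0 < eps by rewrite divr_gt0 ?ltr0Sn.
have xe0 x : 0 <= x -> 0 < x + eps by move=> x0; rewrite ltr_wpDl.
pose g := funmx (fun x => sqrtC (x + eps)) N.
pose gi := funmx (fun x => (sqrtC (x + eps))^-1) N.
pose Gi := funmx (fun x => (x + eps)^-1) N.
have pg : psdmx g by apply: psdmx_funmx => // x x0; rewrite sqrtC_ge0 ltW ?xe0.
have pgi : psdmx gi.
  by apply: psdmx_funmx => // x x0; rewrite invr_ge0 sqrtC_ge0 ltW ?xe0.
have pGi : psdmx Gi by apply: psdmx_funmx => // x x0; rewrite invr_ge0 ltW ?xe0.
have gig : gi *m g = 1%:M.
  rewrite /gi /g funmxM -(funmx_cst 1 N); apply: eq_funmx => // x x0.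
  by rewrite mulVf // sqrtC_eq0 gt_eqF ?xe0.
have gg : g *m g = N + eps%:M.
  rewrite /g funmxM -{2}(funmx_id pN) -(funmx_cst eps N) funmxD.
  by apply: eq_funmx => // x x0; rewrite -expr2 sqrtCK.
have gigi : gi *m gi = Gi.
  by rewrite /gi funmxM; apply: eq_funmx => // x x0; rewrite -invfM -expr2 sqrtCK.
(* [c1] and [c2] are the coefficients of d and d^2 in Tr[G^-1 h rho h]. The choice of [d] below
   gives d c <= e, and d <= 1 lets d^2 be bounded by d. *)
pose c1 := \tr (Gi *m (B *m rho + rho *m B)).
pose c2 := \tr (Gi *m rho).
pose c := `|c1| + `|c2|.
have c0 : 0 <= c by rewrite addr_ge0.
pose d := e / (c + e).
have d0 : 0 < d by rewrite divr_gt0 // ltr_wpDl.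
have d1 : d <= 1 by rewrite ler_pdivrMr ?ltr_wpDl // mul1r lerDr.
have dc : d * c <= e.
  by rewrite /d mulrAC ler_pdivrMr ?ltr_wpDl // ler_wpM2l ?(ltW e0) // lerDl ltW.
clearbody d; have sd0 (x : C) : 0 <= x -> 0 < sqrtC x + d.
  by move=> x0; rewrite ltr_wpDl ?sqrtC_ge0.
pose h := B + d%:M.
pose hi := funmx (fun x => (sqrtC x + d)^-1) sigma.
have hE : h = funmx (fun x => sqrtC x + d) sigma.
  by rewrite /h /B sqrtmxE -(funmx_cst d sigma) funmxD.
have ph : psdmx h by rewrite hE; apply: psdmx_funmx => // x /sd0/ltW.
have phi : psdmx hi by apply: psdmx_funmx => // x x0; rewrite invr_ge0 ltW ?sd0.
have hhi : h *m hi = 1%:M.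
  rewrite hE funmxM -(funmx_cst 1 sigma); apply: eq_funmx => // x x0.
  by rewrite mulfV // gt_eqF ?sd0.
have tr_cycle (p q s : 'M[C]_n) :
    \tr (p *m q *m (q *m p) *m s) = \tr (q *m q *m (p *m s *m p)).
  by rewrite !mulmxA [RHS]mxtrace_mulC !mulmxA.
(* With g = sqrt(G), these factor the two matrices: K K^* = h^-1 G h^-1 and L^* L = h G^-1 h. *)
exists (hi *m g), (gi *m h); split.
- by rewrite mulmxA -(mulmxA gi) hhi mulmx1.
- have -> : \tr ((gi *m h) ^t* *m (gi *m h) *m rho) = \tr (Gi *m (h *m rho *m h)).
    by rewrite adjmxM (psdmx_adj ph) (psdmx_adj pgi) -gigi tr_cycle.
  (* Being nonnegative, the trace equals its modulus, so the triangle inequality applies to its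
     expansion, whose term in d has no evident sign. *)
  have t0 : 0 <= \tr (Gi *m (h *m rho *m h)).
    apply: tr_mul_psdmx_ge0 => //.
    by have := psdmx_conj h pr; rewrite psdmx_adj.
  have hh : h *m rho *m h = N *m N + d *: (B *m rho + rho *m B) + d ^+ 2 *: rho.
    rewrite NN /h !mulmxDl !mulmxDr !mul_scalar_mx !mul_mx_scalar.
    by rewrite -!scalemxAl scalerDr -!addrA scalerA -expr2; congr (_ + _); rewrite addrA.
  rewrite -(ger0_norm t0) hh 2!(mulmxDr Gi) !mxtraceD -!scalemxAr !mxtraceZ.
  rewrite -/c2 -/c1.
  (* On eigenvalues, x^2 / (x + eps) <= x. *)
  have tN : `|\tr (Gi *m (N *m N))| <= F.
    rewrite ger0_norm; last first.
      apply: tr_mul_psdmx_ge0 => //.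
      by have := psdmx_gram N; rewrite psdmx_adj.
    have -> : Gi *m (N *m N) = funmx (fun x => (x + eps)^-1 * (x * x)) N.
      by rewrite -{1 2}(funmx_id pN) !funmxM.
    rewrite FE -{2}(funmx_id pN) !tr_funmx; apply: ler_sum => i _.
    have := spectral_diag_ge0 i pN; move: (spectral_diag N 0 i) => x x0.
    by rewrite mulrC ler_pdivrMr ?xe0 // ler_wpM2l // lerDl ltW.
  apply: (le_trans (ler_normD _ _)); apply: (le_trans (lerD (ler_normD _ _) (lexx _))).
  rewrite -addrA lerD // (le_trans _ dc) // /c mulrDr.
  rewrite !normrM (ger0_norm (ltW d0)) lerD // ler_wpM2r //.
  by rewrite ler_piMr // ltW.
have -> : \tr (hi *m g *m (hi *m g) ^t* *m sigma) =
    \tr ((N + eps%:M) *m (hi *m sigma *m hi)).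
  by rewrite adjmxM (psdmx_adj pg) (psdmx_adj phi) -gg tr_cycle.
(* The matrix h^-1 sigma h^-1 is below the identity because x <= (sqrt x + d)^2. *)
apply: (@le_trans _ _ (\tr ((N + eps%:M) *m 1%:M))).
  apply: ler_tr_mul; first by rewrite -gg -{1}(psdmx_adj pg); apply: psdmx_gram.
  rewrite /loewner_le.
  have -> : hi *m sigma *m hi =
      funmx (fun x => (sqrtC x + d)^-1 * x * (sqrtC x + d)^-1) sigma.
    by rewrite -[X in _ *m X *m _](funmx_id ps) !funmxM.
  rewrite -(funmx_cst 1 sigma) funmxB; apply: psdmx_funmx => // x x0.
  rewrite subr_ge0 ler_pdivrMr ?sd0 // mul1r [X in X <= _]mulrC ler_pdivrMr ?sd0 //.
  by rewrite -[X in X <= _]sqrtCK expr2 ler_pM ?sqrtC_ge0 // lerDl (ltW d0).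
rewrite mulmx1 raddfD /= -FE lerD2l mxtrace_scalar -mulr_natr /eps.
by rewrite mulrAC ler_pdivrMr ?ltr0Sn // ler_wpM2l ?(ltW e0) // ler_nat.
Qed.

End Alberti.

(** Groups the two orderings of each pair, linking the off-diagonal sums of the SDP with the sums
    over i < j in the averages. *)
Lemma sum_neq_lt (V : nmodType) r (f : 'I_r -> 'I_r -> V) :
  \sum_i \sum_(j | i != j) f i j =
  \sum_(i < r) \sum_(j < r | (i < j)%N) (f i j + f j i).
Proof.
have -> : \sum_i \sum_(j | i != j) f i j =
    \sum_(i < r) (\sum_(j < r | (i < j)%N) f i j + \sum_(j < r | (j < i)%N) f i j).
  apply: eq_bigr => i _; rewrite (bigID (fun j : 'I_r => (i < j)%N)) /=.
  by congr (_ + _); apply: eq_bigl => j; rewrite -(inj_eq val_inj) /=; case: ltngtP.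
rewrite big_split /= [X in _ + X](exchange_big_dep predT) //= -big_split /=.
by apply: eq_bigr => i _; rewrite big_split.
Qed.

(** * The semidefinite program *)

Section Blocks.
Local Open Scope sesquilinear_scope.
Variable C : numClosedFieldType.

(** Lets a trace be read as a sum of sesquilinear forms in columns, the shape in which the SDP
    constraint is used. *)
Lemma col_sesqui_diag m n p (A : 'M[C]_(m, n)) Q (B : 'M[C]_(p, n)) k :
  ((col k A) ^t* *m Q *m col k B) 0 0 = (A ^t* *m Q *m B) k k.
Proof.
rewrite !colE adjmxM trmx_delta map_delta_mx -!mulmxA -rowE [LHS]mxE.
by rewrite !mulmxA -colE [LHS]mxE.
Qed.

Lemma sum_mxtens (V : nmodType) r n (F : 'I_(r * n) -> V) :
  \sum_q F q = \sum_i \sum_k F (mxtens_index (i, k)).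
Proof.
rewrite pair_bigA (reindex (@mxtens_index r n)) /=; last first.
  by exists (@mxtens_unindex r n) => ? _; [apply: mxtens_indexK | apply: mxtens_unindexK].
by apply: eq_bigr => -[].
Qed.

(** The i-th component of a vector of C^r tensor C^n, seen as an r-tuple of vectors of C^n. *)
Definition mxtens_block r n (v : 'cV[C]_(r * n)) i : 'cV[C]_n :=
  \col_k v (mxtens_index (i, k)) 0.

Lemma mxtens_blockK r n (w : 'I_r -> 'cV[C]_n) : exists v, mxtens_block v = w.
Proof.
exists (\col_q w (mxtens_unindex q).1 (mxtens_unindex q).2 0).
by apply/funext => i; apply/colP => k; rewrite !mxE mxtens_indexK.
Qed.

Lemma sesqui_delta_tens r n (v : 'cV[C]_(r * n)) i j (M : 'M[C]_n) :
  (v ^t* *m (delta_mx i j *t M) *m v) 0 0 =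
  ((mxtens_block v i) ^t* *m M *m mxtens_block v j) 0 0.
Proof.
rewrite mxE sum_mxtens (bigD1 j) //= [X in _ + X]big1 ?addr0; last first.
  move=> l lj; rewrite big1 // => k _; rewrite mxE big1 ?mul0r // => q _.
  case: (mxtens_indexP q) => a b.
  by rewrite tensmxE [delta_mx _ _ _ _]mxE (negPf lj) andbF mul0r mulr0.
rewrite mxE; apply: eq_bigr => k _; rewrite [in RHS]mxE; congr (_ * _); last by rewrite mxE.
rewrite [in LHS]mxE sum_mxtens (bigD1 i) //= [X in _ + X]big1 ?addr0; last first.
  move=> l li; rewrite big1 // => b _.
  by rewrite tensmxE [delta_mx _ _ _ _]mxE (negPf li) mul0r mulr0.
by apply: eq_bigr => b _; rewrite tensmxE [delta_mx _ _ _ _]mxE !eqxx mul1r !mxE.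
Qed.

Lemma adjmx_delta_tens r n (i j : 'I_r) (M : 'M[C]_n) :
  (delta_mx i j *t M) ^t* = delta_mx j i *t (M ^t*).
Proof. by rewrite trmx_tens map_mxT trmx_delta map_delta_mx. Qed.

(** Removes tensor products from the SDP constraint: vectors of C^r tensor C^n are exactly r-tuples
    of blocks. In the converse direction, the difference is Hermitian because each [Y i] is and
    because the condition i != j is symmetric. *)
Lemma loewner_le_blocks r n (Y : 'I_r -> 'M[C]_n) : (forall i, psdmx (Y i)) ->
  loewner_le
    (\sum_(i < r) \sum_(j < r | i != j) delta_mx i j *t (1%:M : 'M[C]_n))
    (\sum_(i < r) delta_mx i i *t Y i) <->
  forall w : 'I_r -> 'cV[C]_n,
    \sum_(i < r) \sum_(j < r | i != j) ((w i) ^t* *m w j) 0 0 <=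
    \sum_(i < r) ((w i) ^t* *m Y i *m w i) 0 0.
Proof.
move=> pY; set U := \sum_i \sum_(j | _) _; set D := \sum_i _.
have UE (v : 'cV[C]_(r * n)) : (v ^t* *m U *m v) 0 0 =
    \sum_i \sum_(j | i != j) ((mxtens_block v i) ^t* *m mxtens_block v j) 0 0.
  rewrite mulmx_sumr mulmx_suml summxE; apply: eq_bigr => i _.
  rewrite mulmx_sumr mulmx_suml summxE; apply: eq_bigr => j _.
  by rewrite sesqui_delta_tens mulmx1.
have DE (v : 'cV[C]_(r * n)) : (v ^t* *m D *m v) 0 0 =
    \sum_i ((mxtens_block v i) ^t* *m Y i *m mxtens_block v i) 0 0.
  rewrite mulmx_sumr mulmx_suml summxE; apply: eq_bigr => i _.
  exact: sesqui_delta_tens.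
have DU v : (v ^t* *m (D - U) *m v) 0 0 = (v ^t* *m D *m v) 0 0 - (v ^t* *m U *m v) 0 0.
  by rewrite mulmxBr mulmxBl [LHS]mxE [X in _ + X]mxE.
split=> [[_ pos] w|pos].
  have [v <-] := mxtens_blockK w.
  by rewrite -subr_ge0 -UE -DE -DU.
apply: psdmxI => [|v]; last by rewrite DU subr_ge0 UE DE.
rewrite adjmxB; congr (_ - _).
  by rewrite adjmx_sum; apply: eq_bigr => i _; rewrite adjmx_delta_tens psdmx_adj.
rewrite adjmx_sum /U (exchange_big_dep predT) //=; apply: eq_bigr => i _.
rewrite adjmx_sum; apply: eq_big => [j|j _]; first by rewrite eq_sym.
by rewrite adjmx_delta_tens adjmx1.
Qed.

Lemma sqr_sum_fidelity_le n r (rho : 'I_r -> 'M[C]_n) sigma (Y : 'I_r -> 'M[C]_n) :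
  (forall i, quantum_state (rho i)) -> quantum_state sigma ->
  (forall i, psdmx (Y i)) ->
  (forall w : 'I_r -> 'cV[C]_n,
    \sum_(i < r) \sum_(j < r | i != j) ((w i) ^t* *m w j) 0 0 <=
    \sum_(i < r) ((w i) ^t* *m Y i *m w i) 0 0) ->
  (\sum_i trace_norm (sqrtmx (rho i) *m sqrtmx sigma)) ^+ 2 <=
    r%:R + \sum_i \tr (Y i *m rho i).
Proof.
move=> qr qs pY blocks.
have /fin_all_exists [W WP] := fun i => tr_polar (sqrtmx (rho i) *m sqrtmx sigma).
have pA i := psdmx_sqrt (qr i).1; have pS := psdmx_sqrt qs.1.
pose M i := sqrtmx (rho i) *m W i; pose T := \sum_i M i.
have F0 : 0 <= \sum_i trace_norm (sqrtmx (rho i) *m sqrtmx sigma).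
  by apply: sumr_ge0 => i _; apply: trace_norm_ge0.
have FE : \sum_i trace_norm (sqrtmx (rho i) *m sqrtmx sigma) =
    \tr (sqrtmx sigma *m (T ^t*) ^t*).
  rewrite trmxCK mulmx_sumr raddf_sum; apply: eq_bigr => i _.
  by rewrite /= /M (WP i).1 adjmxM (psdmx_adj (pA i)) (psdmx_adj pS) mulmxA.
rewrite -(ger0_norm F0) FE; apply: (le_trans (tr_CauchySchwarz _ _)).
rewrite psdmx_adj // tr_sqrtmx_state // mul1r trmxCK.
(* The constraint controls only the terms i != j of Tr[T^* T]; the summand [1%:M] accounts for the
   diagonal ones. The comparison with rho_i uses M_i M_i^* = A_i W_i W_i^* A_i <= rho_i, and the
   traces of the rho_i add up to r. *)
apply: (@le_trans _ _ (\sum_i \tr ((1%:M + Y i) *m (M i *m (M i) ^t*)))); last first.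
  rewrite -[r in r%:R]card_ord -sum1_card natr_sum -big_split /=.
  apply: ler_sum => i _.
  have -> : 1 + \tr (Y i *m rho i) = \tr ((1%:M + Y i) *m rho i).
    by rewrite mulmxDl mul1mx mxtraceD (qr i).2.
  apply: ler_tr_mul; first by apply: psdmxD => //; apply: psdmx1.
  rewrite /loewner_le adjmxM (psdmx_adj (pA i)).
  have := psdmx_conj (sqrtmx (rho i)) (WP i).2.
  by rewrite (psdmx_adj (pA i)) mulmxBr mulmxBl mulmx1 (sqrtmxK (qr i).1) !mulmxA.
have -> : \sum_i \tr ((1%:M + Y i) *m (M i *m (M i) ^t*)) =
    \sum_k \sum_i (((col k (M i)) ^t* *m col k (M i)) 0 0 +
                   ((col k (M i)) ^t* *m Y i *m col k (M i)) 0 0).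
  rewrite [RHS]exchange_big; apply: eq_bigr => i _ /=.
  rewrite mulmxA mxtrace_mulC mulmxA mulmxDr mulmxDl mulmx1 /mxtrace.
  apply: eq_bigr => k _; rewrite col_sesqui_diag mxE; congr (_ + _).
  (* An identity matrix is inserted between the two columns so that [col_sesqui_diag] applies. *)
  by rewrite -[_ ^t* *m col _ _](congr1 (mulmx^~ _) (mulmx1 _)) col_sesqui_diag mulmx1.
rewrite /mxtrace; apply: ler_sum => k _.
have -> : (T ^t* *m T) k k = \sum_i \sum_j ((col k (M i)) ^t* *m col k (M j)) 0 0.
  rewrite adjmx_sum mulmx_suml summxE; apply: eq_bigr => i _.
  rewrite mulmx_sumr summxE; apply: eq_bigr => j _.
  by rewrite -[_ ^t* *m col _ _](congr1 (mulmx^~ _) (mulmx1 _)) col_sesqui_diag mulmx1.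
have -> : \sum_i \sum_j ((col k (M i)) ^t* *m col k (M j)) 0 0 =
    \sum_i (((col k (M i)) ^t* *m col k (M i)) 0 0 +
      \sum_(j | i != j) ((col k (M i)) ^t* *m col k (M j)) 0 0).
  apply: eq_bigr => i _; rewrite (bigD1 i) //=; congr (_ + _).
  by apply: eq_bigl => j; rewrite eq_sym.
by rewrite !big_split lerD2l /= (blocks (fun i => col k (M i))).
Qed.

Lemma tr_sqr_sum_sqrtmx n r (rho : 'I_r -> 'M[C]_n) :
  (forall i, quantum_state (rho i)) ->
  \tr ((\sum_i sqrtmx (rho i)) *m (\sum_i sqrtmx (rho i))) =
  r%:R + 2 * \sum_(i < r) \sum_(j < r | (i < j)%N)
    \tr (sqrtmx (rho i) *m sqrtmx (rho j)).
Proof.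
move=> qr; rewrite mulmx_suml raddf_sum /=.
have -> : \sum_i \tr (sqrtmx (rho i) *m \sum_j sqrtmx (rho j)) =
    \sum_i (1 + \sum_(j | i != j) \tr (sqrtmx (rho i) *m sqrtmx (rho j))).
  apply: eq_bigr => i _; rewrite mulmx_sumr raddf_sum (bigD1 i) //=.
  rewrite tr_sqrtmx_state //; congr (_ + _).
  by apply: eq_bigl => j; rewrite eq_sym.
rewrite big_split /= sumr_const card_ord; congr (_ + _).
rewrite sum_neq_lt mulr_sumr; apply: eq_bigr => i _.
rewrite mulr_sumr; apply: eq_bigr => j _.
by rewrite [X in _ + X]mxtrace_mulC -mulr2n mulr_natl.
Qed.

(** Expand the squared norm of L v - K^* w; its cross terms simplify because K L = 1 as well, the
    matrices being square. *)
Lemma cross_le_alberti n (K L : 'M[C]_n) (v w : 'cV[C]_n) : L *m K = 1%:M ->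
  (v ^t* *m w) 0 0 + (w ^t* *m v) 0 0 <=
  (v ^t* *m (L ^t* *m L) *m v) 0 0 + (w ^t* *m (K *m K ^t*) *m w) 0 0.
Proof.
move=> LK; have KL : K *m L = 1%:M by apply: mulmx1C.
rewrite -subr_ge0; have := psdmx_diag_ge0 0 (psdmx_gram (L *m v - K ^t* *m w)).
rewrite adjmxB !adjmxM trmxCK mulmxBl !mulmxBr.
have -> : v ^t* *m L ^t* *m (K ^t* *m w) = v ^t* *m w.
  by rewrite mulmxA -(mulmxA (v ^t*)) -adjmxM KL adjmx1 mulmx1.
have -> : w ^t* *m K *m (L *m v) = w ^t* *m v.
  by rewrite mulmxA -(mulmxA (w ^t*)) KL mulmx1.
have entryE (a b c d : 'M[C]_1) :
    (a - b - (c - d)) 0 0 = a 0 0 + d 0 0 - (b 0 0 + c 0 0).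
  by rewrite !mxE opprB opprD addrACA.
by rewrite entryE !mulmxA.
Qed.

(** Feasibility is [cross_le_alberti] summed over pairs. Each of the two traces of a pair exceeds
    the fidelity by at most [e], whence the factor 2. *)
Lemma exists_SDP_feasible_le n r (rho : 'I_r -> 'M[C]_n) (e : C) :
  (forall i, psdmx (rho i)) -> 0 < e ->
  exists Y : 'I_r -> 'M[C]_n, [/\ forall i, psdmx (Y i),
    forall w : 'I_r -> 'cV[C]_n,
      \sum_(i < r) \sum_(j < r | i != j) ((w i) ^t* *m w j) 0 0 <=
      \sum_(i < r) ((w i) ^t* *m Y i *m w i) 0 0 &
    \sum_i \tr (Y i *m rho i) <= \sum_(i < r) \sum_(j < r | (i < j)%N)
      2 * (trace_norm (sqrtmx (rho i) *m sqrtmx (rho j)) + e)].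
Proof.
move=> pr e0.
have /fin_all_exists [K /fin_all_exists [L KL]] :
    forall ij : 'I_r * 'I_r, exists K L : 'M[C]_n, [/\ L *m K = 1%:M,
      \tr (L ^t* *m L *m rho ij.1) <=
        trace_norm (sqrtmx (rho ij.1) *m sqrtmx (rho ij.2)) + e &
      \tr (K *m K ^t* *m rho ij.2) <=
        trace_norm (sqrtmx (rho ij.1) *m sqrtmx (rho ij.2)) + e].
  by move=> ij; apply: exists_alberti_pair.
(* Both orderings of a pair use the matrices chosen for its increasing ordering, so that [Z i j] and
   [Z j i] are mutually inverse for i != j. *)
pose Z (i j : 'I_r) := if (i < j)%N then (L (i, j)) ^t* *m L (i, j)
              else K (j, i) *m (K (j, i)) ^t*.
have ZL (i j : 'I_r) : (i < j)%N -> Z i j = (L (i, j)) ^t* *m L (i, j) by rewrite /Z => ->.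
have ZK (i j : 'I_r) : (i < j)%N -> Z j i = K (i, j) *m (K (i, j)) ^t*.
  by move=> ij; rewrite /Z ltnNge (ltnW ij).
exists (fun i => \sum_(j | i != j) Z i j); split=> [i|w|].
- apply: psdmx_sum => j _; rewrite /Z; case: ifP => _; first exact: psdmx_gram.
  by rewrite -{1}[K _]trmxCK; apply: psdmx_gram.
- have -> : \sum_i ((w i) ^t* *m (\sum_(j | i != j) Z i j) *m w i) 0 0 =
      \sum_i \sum_(j | i != j) ((w i) ^t* *m Z i j *m w i) 0 0.
    by apply: eq_bigr => i _; rewrite mulmx_sumr mulmx_suml summxE.
  rewrite !sum_neq_lt; apply: ler_sum => i _; apply: ler_sum => j ij.
  rewrite ZL // ZK //; apply: cross_le_alberti.
  by have [] := KL (i, j).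
have -> : \sum_i \tr ((\sum_(j | i != j) Z i j) *m rho i) =
    \sum_i \sum_(j | i != j) \tr (Z i j *m rho i).
  by apply: eq_bigr => i _; rewrite mulmx_suml raddf_sum.
rewrite sum_neq_lt; apply: ler_sum => i _; apply: ler_sum => j ij.
rewrite ZL // ZK // mulr2n mulrDl !mul1r.
by have [_ ? ?] := KL (i, j); apply: lerD.
Qed.
End Blocks.

(** * Suprema and infima over the reals *)

Section RealFidelities.
Local Open Scope sesquilinear_scope.
Local Open Scope complex_scope.
Variable R : realType.

(** A nonnegative element of [R[i]] is real, so [complex.Re] loses nothing; this carries the matrix
    inequalities over to [R]. *)
Lemma Re_ge0K (z : R[i]) : 0 <= z -> (complex.Re z)%:C = z.
Proof. by move=> z0; rewrite RRe_real ?ger0_real. Qed.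

Section Pair.
Variables (n : nat) (rho sigma : 'M[R[i]]_n).

Lemma fidelityE :
  (fidelity rho sigma)%:C = trace_norm (sqrtmx rho *m sqrtmx sigma).
Proof. by rewrite Re_ge0K ?trace_norm_ge0. Qed.

Lemma fidelity_ge0 : 0 <= fidelity rho sigma.
Proof. by rewrite -lecR fidelityE trace_norm_ge0. Qed.

Lemma holevo_fidelityE : psdmx rho -> psdmx sigma ->
  (holevo_fidelity rho sigma)%:C = \tr (sqrtmx rho *m sqrtmx sigma).
Proof.
move=> pr ps; apply: Re_ge0K.
exact: tr_mul_psdmx_ge0 (psdmx_sqrt pr) (psdmx_sqrt ps).
Qed.

Lemma fidelity_le1 : quantum_state rho -> quantum_state sigma ->
  fidelity rho sigma <= 1.
Proof. by move=> qr qs; rewrite -lecR fidelityE trace_norm_sqrtmx_le1. Qed.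

Lemma sqr_fidelity_le_holevo : quantum_state rho -> quantum_state sigma ->
  fidelity rho sigma ^+ 2 <= holevo_fidelity rho sigma.
Proof.
move=> qr qs; rewrite -lecR rmorphXn /= fidelityE.
by rewrite (holevo_fidelityE qr.1 qs.1) sqr_trace_norm_sqrtmx_le.
Qed.
End Pair.

Variables (n r : nat) (rho : 'I_r -> 'M[R[i]]_n).
Hypotheses (hr : (2 <= r)%N) (hrho : forall i, quantum_state (rho i)).

Lemma natr_ge2_gt0 : 0 < r%:R :> R.
Proof. by rewrite ltr0n (leq_trans _ hr). Qed.

Lemma natr_ge2_sub1_gt0 : 0 < r%:R - 1 :> R.
Proof. by rewrite subr_gt0 ltr1n. Qed.

(** Counts ordered pairs of distinct indices in two ways; it normalizes the averages. *)
Lemma sum_lt1 : (\sum_(i < r) \sum_(j < r | (i < j)%N) 1) * 2 =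
  r%:R * (r%:R - 1) :> R.
Proof.
have := sum_neq_lt (fun _ _ : 'I_r => 1 : R).
rewrite mulr_suml; under [in RHS]eq_bigr do under eq_bigr do rewrite -[1 + 1]mul1r.
under [in RHS]eq_bigr do rewrite -mulr_suml.
move=> <-; under eq_bigr => i _.
  have -> : \sum_(j | i != j) 1 = r%:R - 1 :> R.
    apply/eqP; rewrite eq_sym subr_eq -[r in r%:R]card_ord -sum1_card natr_sum.
    rewrite (bigD1 i) //= addrC; apply/eqP; congr (_ + _).
    by apply: eq_bigl => j; rewrite eq_sym.
  over.
by rewrite sumr_const card_ord mulr_natl.
Qed.

(* Jensen's inequality: expand avg (F - avg F)^2 >= 0. *)
Lemma F_U_le_sqrt_F_H : F_U rho <= Num.sqrt (F_H rho).
Proof.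
have m0 : 0 <= F_U rho.
  apply: mulr_ge0; last first.
    by do 2!apply: sumr_ge0 => ? _; apply: fidelity_ge0.
  by rewrite divr_ge0 // mulr_ge0 ?(ltW natr_ge2_gt0) ?(ltW natr_ge2_sub1_gt0).
rewrite -(ger0_norm m0) -sqrtr_sqr; apply: ler_wsqrtr.
have w0 : 0 <= 2 / (r%:R * (r%:R - 1)) :> R.
  by rewrite divr_ge0 // mulr_ge0 ?(ltW natr_ge2_gt0) ?(ltW natr_ge2_sub1_gt0).
set w := 2 / _ in w0 *; set m := F_U rho in m0 *.
have w1 : w * \sum_(i < r) \sum_(j < r | (i < j)%N) 1 = 1.
  rewrite /w mulrAC [2 * _]mulrC sum_lt1 mulfV // mulf_neq0 ?gt_eqF ?natr_ge2_gt0 //.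
  exact: natr_ge2_sub1_gt0.
have mE : w * \sum_(i < r) \sum_(j < r | (i < j)%N) fidelity (rho i) (rho j) = m by [].
(* The square of the fidelity is already replaced by the larger Holevo fidelity. The factor 1 after
   [m ^+ 2] is kept so that its sum matches [w1]. *)
have : 0 <= w * \sum_(i < r) \sum_(j < r | (i < j)%N)
    (holevo_fidelity (rho i) (rho j) - m * 2 * fidelity (rho i) (rho j) + m ^+ 2 * 1).
  apply: mulr_ge0 => //; apply: sumr_ge0 => i _; apply: sumr_ge0 => j _.
  have := sqr_fidelity_le_holevo (hrho i) (hrho j).
  move: (fidelity _ _) (holevo_fidelity _ _) => f h fh.
  apply: (le_trans (sqr_ge0 (f - m))).
  have -> : (f - m) ^+ 2 = f ^+ 2 - m * 2 * f + m ^+ 2 * 1 by ring.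
  by rewrite !lerD2r.
under eq_bigr do rewrite big_split sumrB -!mulr_sumr /=.
rewrite big_split sumrB -!mulr_sumr /= mulrDr mulrBr.
rewrite [w * (m ^+ 2 * _)]mulrCA w1 mulr1 [w * (m * 2 * _)]mulrCA mE.
have -> : w * \sum_(i < r) \sum_(j < r | (i < j)%N) holevo_fidelity (rho i) (rho j) =
  F_H rho by [].
by rewrite [m * 2]mulr_natr mulrnAl -expr2 mulr2n opprD addrA subrK subr_ge0.
Qed.

Let SDP_values := [set complex.Re (\sum_(i < r) \tr (Y i *m rho i))
        | Y in [set Y : 'I_r -> 'M[R[i]]_n | SDP_feasible Y]]%classic.

Lemma SDP_valueE (Y : 'I_r -> 'M[R[i]]_n) : (forall i, psdmx (Y i)) ->
  (complex.Re (\sum_(i < r) \tr (Y i *m rho i)))%:C = \sum_(i < r) \tr (Y i *m rho i).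
Proof.
move=> pY; rewrite Re_ge0K // sumr_ge0 // => i _.
exact: tr_mul_psdmx_ge0 (pY i) (hrho i).1.
Qed.

(** [inf] is meaningful only on nonempty sets bounded below; this is the bound, and
    [exists_SDP_value_le] gives nonemptiness. *)
Lemma SDP_values_lb0 : lbound SDP_values 0.
Proof.
move=> _ [Y [pY _] <-]; rewrite -lecR SDP_valueE // sumr_ge0 // => i _.
exact: tr_mul_psdmx_ge0 (pY i) (hrho i).1.
Qed.

Lemma exists_SDP_value_le (e : R) : 0 < e -> exists2 x, SDP_values x &
  x <= \sum_(i < r) \sum_(j < r | (i < j)%N) 2 * (fidelity (rho i) (rho j) + e).
Proof.
move=> e0; have e0' : 0 < e%:C by rewrite ltcR.
have [Y [pY blocks le]] := exists_SDP_feasible_le (fun i => (hrho i).1) e0'.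
exists (complex.Re (\sum_(i < r) \tr (Y i *m rho i))).
  by exists Y => //; split=> //; apply/loewner_le_blocks.
rewrite -lecR SDP_valueE // (le_trans le) // rmorph_sum /=; apply: ler_sum => i _.
rewrite rmorph_sum /=; apply: ler_sum => j _.
by rewrite rmorphM rmorph_nat rmorphD /= fidelityE.
Qed.

Lemma F_SDP_le_F_U : F_SDP rho <= F_U rho.
Proof.
have k0 : 0 < r%:R * (r%:R - 1) :> R by rewrite mulr_gt0 ?natr_ge2_gt0 ?natr_ge2_sub1_gt0.
rewrite /F_SDP /F_U /avg_pairwise [2 / _]mulrC -mulrA ler_pM2l ?invr_gt0 //.
apply/ler_addgt0Pr => e e0.
(* The slack e / (r (r - 1)) is counted twice for each of the r (r - 1) / 2 pairs, hence totals
   e. *)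
have [x xV xle] := exists_SDP_value_le (divr_gt0 e0 k0).
apply: (@le_trans _ _ x); first by apply: ge_inf => //; exists 0; apply: SDP_values_lb0.
apply: (le_trans xle).
under eq_bigr do rewrite -mulr_sumr big_split /=.
rewrite -mulr_sumr big_split /= mulrDr lerD2l.
under eq_bigr do under eq_bigr do rewrite -[_ / _]mulr1.
under eq_bigr do rewrite -mulr_sumr.
by rewrite -mulr_sumr mulrCA [2 * _]mulrC sum_lt1 divfK ?gt_eqF.
Qed.

Let secrecy_values := [set r%:R^-1 * \sum_(i < r) fidelity (rho i) sigma
      | sigma in [set sigma : 'M[R[i]]_n | quantum_state sigma]]%classic.

(** A state of the tuple itself serves as a candidate sigma, and fidelities are at most 1. *)
Lemma has_sup_secrecy : has_sup secrecy_values.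
Proof.
split; first by eexists; exists (rho (Ordinal (ltnW hr))); [apply: hrho | reflexivity].
exists 1 => _ [sigma qs <-].
rewrite mulrC ler_pdivrMr ?natr_ge2_gt0 // mul1r -[r in r%:R]card_ord -sum1_card natr_sum.
by apply: ler_sum => i _; apply: fidelity_le1.
Qed.

Lemma secrecy_ge0 : 0 <= secrecy rho.
Proof.
have [[x xV] _] := has_sup_secrecy.
apply: (@le_trans _ _ x); last exact: sup_upper_bound has_sup_secrecy _ xV.
case: xV => sigma _ <-; rewrite mulr_ge0 ?invr_ge0 ?(ltW natr_ge2_gt0) //.
by apply: sumr_ge0 => i _; apply: fidelity_ge0.
Qed.

Lemma F_S_le_F_SDP : F_S rho <= F_SDP rho.
Proof.
rewrite /F_S /F_SDP invfM [_^-1 * _^-1]mulrC -mulrA ler_pM2l ?invr_gt0 ?natr_ge2_sub1_gt0 //.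
rewrite [_^-1 * _]mulrC ler_pdivlMr ?natr_ge2_gt0 //.
have r0 := natr_ge2_gt0.
have -> : (r%:R * secrecy rho ^+ 2 - 1) * r%:R = (r%:R * secrecy rho) ^+ 2 - r%:R.
  by rewrite mulrBl mul1r exprMn expr2 [in RHS]mulrAC.
apply: lb_le_inf => [|x [Y [pY fY] <-]].
  by have [x xV _] := exists_SDP_value_le ltr01; exists x.
rewrite lerBlDl; set X := complex.Re _.
have X0 : 0 <= r%:R + X.
  by rewrite addr_ge0 ?(ltW r0) //; apply: SDP_values_lb0; exists Y.
(* Taking the square root makes the bound linear in [secrecy], so it can be proved for each sigma
   and passed to the supremum. *)
suff : r%:R * secrecy rho <= Num.sqrt (r%:R + X).
  move=> le; rewrite -[X in _ <= X]sqr_sqrtr // ler_pXn2r ?nnegrE ?sqrtr_ge0 //.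
  by rewrite mulr_ge0 ?secrecy_ge0 ?(ltW r0).
rewrite mulrC -ler_pdivlMr //; apply: ge_sup; first by have [] := has_sup_secrecy.
move=> _ [sigma qs <-]; rewrite mulrC ler_pM2r ?invr_gt0 //.
have s0 : 0 <= \sum_(i < r) fidelity (rho i) sigma.
  by apply: sumr_ge0 => i _; apply: fidelity_ge0.
rewrite -(ger0_norm s0) -sqrtr_sqr; apply: ler_wsqrtr.
rewrite -lecR rmorphXn rmorph_sum rmorphD rmorph_nat /= SDP_valueE //.
under eq_bigr do rewrite fidelityE.
by apply: sqr_sum_fidelity_le => //; apply/loewner_le_blocks.
Qed.

(** Multiplied by r (r - 1), the claim reads r + 2 H <= (r S)^2, with H the sum of Holevo fidelities
    over pairs and S the secrecy. *)
Lemma F_H_le_F_S : F_H rho <= F_S rho.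
Proof.
have r0 := natr_ge2_gt0; have r1 := natr_ge2_sub1_gt0.
have [sigma qs] := exists_state_sum_fidelity_ge (ltnW hr) hrho.
set H := \sum_(i < r) \sum_(j < r | (i < j)%N) holevo_fidelity (rho i) (rho j).
have HE : H%:C = \sum_(i < r) \sum_(j < r | (i < j)%N)
    \tr (sqrtmx (rho i) *m sqrtmx (rho j)).
  rewrite rmorph_sum; apply: eq_bigr => i _; rewrite rmorph_sum; apply: eq_bigr => j _.
  exact: holevo_fidelityE (hrho i).1 (hrho j).1.
rewrite (tr_sqr_sum_sqrtmx hrho) -HE.
have -> : r%:R + 2 * H%:C = (r%:R + 2 * H)%:C by rewrite rmorphD rmorphM !rmorph_nat.
under eq_bigr do rewrite -fidelityE.
rewrite -rmorph_sum /= => le.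
have H0 : 0 <= H.
  do 2!apply: sumr_ge0 => ? _.
  exact: le_trans (sqr_ge0 _) (sqr_fidelity_le_holevo (hrho _) (hrho _)).
have t0 : 0 <= r%:R + 2 * H by rewrite addr_ge0 ?mulr_ge0 ?(ltW r0).
have {}le : r%:R + 2 * H <= (r%:R * secrecy rho) ^+ 2.
  apply: (@le_trans _ _ ((\sum_(i < r) fidelity (rho i) sigma) ^+ 2)).
    rewrite -lecR rmorphXn /= -[X in X <= _]sqrtCK ler_pXn2r ?nnegrE //.
      by rewrite sqrtC_ge0 lecR.
    by rewrite lecR; apply: sumr_ge0 => i _; apply: fidelity_ge0.
  rewrite ler_pXn2r ?nnegrE ?mulr_ge0 ?secrecy_ge0 ?(ltW r0) //; last first.
    by apply: sumr_ge0 => i _; apply: fidelity_ge0.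
  rewrite -ler_pdivrMl //; apply: (sup_upper_bound has_sup_secrecy).
  by exists sigma.
rewrite /F_H /F_S /avg_pairwise -/H.
have [r0' r1'] : r%:R != 0 :> R /\ r%:R - 1 != 0 :> R by rewrite !gt_eqF.
have -> : 2 / (r%:R * (r%:R - 1)) * H = (r%:R * (r%:R - 1))^-1 * (2 * H).
  by rewrite mulrAC mulrC.
have -> : (r%:R - 1)^-1 * (r%:R * secrecy rho ^+ 2 - 1) =
    (r%:R * (r%:R - 1))^-1 * ((r%:R * secrecy rho) ^+ 2 - r%:R).
  by field; rewrite r0' r1'.
by rewrite ler_pM2l ?invr_gt0 ?mulr_gt0 // lerBrDl.
Qed.
End RealFidelities.

Theorem mainTheorem11 (R : realType) (n r : nat) (rho : 'I_r -> 'M[R[i]]_n)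
    (hr : (2 <= r)%N) (hrho : forall i : 'I_r, quantum_state (rho i)) :
  [/\ F_H rho <= F_S rho,
      F_S rho <= F_SDP rho,
      F_SDP rho <= F_U rho
    & F_U rho <= Num.sqrt (F_H rho)].
Proof.
split; [exact: F_H_le_F_S | exact: F_S_le_F_SDP | exact: F_SDP_le_F_U |].
exact: F_U_le_sqrt_F_H.
Qed.
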